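(* The closure of $\mathrm{Conv}(\mathcal M_{\mathrm{PR}})$ in the topology of componentwise weak convergence equals $\mathcal M_{\mathrm{NS}}$. In particular, for every $\boldsymbol\mu\in\mathcal M_{\mathrm{NS}}$ there exists a sequence $(\boldsymbol\mu_n)_{n\in\mathbb N}$ in $\mathrm{Conv}(\mathcal M_{\mathrm{PR}})$ such that $[\boldsymbol\mu_n]_{x,y}\to[\boldsymbol\mu]_{x,y}$ weakly for all $x,y\in\{0,1\}$; that is, $\mathrm{Conv}(\mathcal M_{\mathrm{PR}})$ is dense in $\mathcal M_{\mathrm{NS}}$.
   Context: A behaviour is a family $\boldsymbol\mu=(\mu_{x,y})_{x,y\in\{0,1\}}$ of Borel probability measures on $\mathbb R\times\mathbb R$, with $[\boldsymbol\mu]_{x,y}:=\mu_{x,y}$; convex combinations are componentwise. It is no-signaling if $\mu_{x,0}(A\times\mathbb R)=\mu_{x,1}(A\times\mathbb R)$ for all $x\in\{0,1\}$ and Borel $A\subseteq\mathbb R$, and $\mu_{0,y}(\mathbb R\times B)=\mu_{1,y}(\mathbb R\times B)$ for all $y\in\{0,1\}$ and Borel $B$; $\mathcal M_{\mathrm{NS}}$ is the set of no-signaling behaviours. $\delta_{a,b}$ is the Dirac measure at $(a,b)\in\mathbb R^2$. A CV PR box of order $k\in\mathbb N$ is a behaviour with $\mu_{x,y}=\frac1k\sum_{j=1}^k\delta_{a_{x,j},\,b_{y,[j+xy]_k}}$, where for each $x,y$ the vectors $\boldsymbol a_x,\boldsymbol b_y\in\mathbb R^k$ each have pairwise distinct components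 and $[\,\cdot\,]_k$ is reduction modulo $k$ into $\{1,\dots,k\}$; $\mathcal M_{\mathrm{PR}}$ is the set of all CV PR boxes of all orders. $\mathrm{Conv}(\mathcal M)$ is the set of all finite convex combinations $\sum_{i=1}^n q_i\boldsymbol\mu_i$ with $\boldsymbol\mu_i\in\mathcal M$, $q_i\ge0$, $\sum_iq_i=1$. A sequence of probability measures $\mu_n$ converges weakly to $\mu$ if $\int f\,d\mu_n\to\int f\,d\mu$ for every bounded continuous $f:\mathbb R^2\to\mathbb R$; behaviours converge if every component does. *)

(* Defs.v *)
From HB Require Import structures.
From mathcomp Require Import all_boot all_order all_algebra.
From mathcomp Require Import all_classical all_reals all_analysis.
Set Implicit Arguments. Unset Strict Implicit. Unset Printing Implicit Defensive.
Import Order.TTheory GRing.Theory Num.Theory.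
Import numFieldNormedType.Exports.
Local Open Scope classical_set_scope.
Local Open Scope ring_scope.

(** Borel probability measures on R x R (product sigma-algebra of the Borel
    sigma-algebras, which coincides with the Borel sigma-algebra of R^2). *)
Definition pmeasR2 (R : realType) := probability (R * R)%type R.

Definition behaviour (R : realType) := bool -> bool -> pmeasR2 R.

Definition no_signaling (R : realType) (mu : behaviour R) : Prop :=
  (forall (x : bool) (A : set R), measurable A ->
     mu x false (A `*` setT) = mu x true (A `*` setT)) /\
  (forall (y : bool) (B : set R), measurable B ->
     mu false y (setT `*` B) = mu true y (setT `*` B)).

(** CV PR box of order k (k >= 1), indices 0..k-1 (the paper's 1..k shifted):
    mu_{x,y} = 1/k sum_j delta_(a_{x,j}, b_{y,[j+xy]_k}), with each a_x, b_y
    having pairwise distinct components. *)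
Definition is_PR_box (R : realType) (mu : behaviour R) : Prop :=
  exists (k : nat) (kpos : (0 < k)%N) (a b : bool -> 'I_k -> R),
    (forall x, injective (a x)) /\ (forall y, injective (b y)) /\
    forall (x y : bool) (A : set (R * R)%type), measurable A ->
      mu x y A =
      (\sum_(j < k)
         ((k%:R)^-1)%:E *
           \d_(a x j, b y (Ordinal (ltn_pmod (j + (x * y)%N) kpos))) A)%E.

Definition in_conv_PR (R : realType) (mu : behaviour R) : Prop :=
  exists (n : nat) (q : 'I_n -> R) (B : 'I_n -> behaviour R),
    (forall i, 0 <= q i) /\ (\sum_(i < n) q i = 1) /\
    (forall i, is_PR_box (B i)) /\
    forall (x y : bool) (A : set (R * R)%type), measurable A ->
      mu x y A = (\sum_(i < n) (q i)%:E * B i x y A)%E.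

Definition bounded_continuous (R : realType) (f : (R * R)%type -> R) : Prop :=
  continuous f /\ exists M : R, forall z, `|f z| <= M.

Definition integ (R : realType) (nu : pmeasR2 R) (f : (R * R)%type -> R) :
  \bar R := (\int[nu]_z (f z)%:E)%E.

Definition weak_cvg (R : realType) (mun : nat -> behaviour R)
    (mu : behaviour R) : Prop :=
  forall (x y : bool) (f : (R * R)%type -> R), bounded_continuous f ->
    (fun n => integ (mun n x y) f) @ \oo --> integ (mu x y) f.

(** mu lies in the closure of Conv(M_PR) for the topology of componentwise
    weak convergence: every basic open neighbourhood of mu, given by finitely
    many (x, y, f) with f bounded continuous and a radius eps > 0, meets
    Conv(M_PR). *)
Definition in_weak_closure_conv_PR (R : realType) (mu : behaviour R) : Prop :=
  forall (s : seq (bool * bool * ((R * R)%type -> R))) (eps : R),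
    (forall t, t \in s -> bounded_continuous t.2) -> 0 < eps ->
    exists nu : behaviour R, in_conv_PR nu /\
      forall t, t \in s ->
        (`| integ (nu t.1.1 t.1.2) t.2 - integ (mu t.1.1 t.1.2) t.2 | <
           eps%:E)%E.

(* Main.v *)
Require Import Defs.
From HB Require Import structures.
From mathcomp Require Import all_boot all_order all_algebra.
From mathcomp Require Import zify finmap.
From mathcomp Require Import all_classical all_reals all_analysis.
From mathcomp Require Import measurable_realfun.
Set Implicit Arguments. Unset Strict Implicit. Unset Printing Implicit Defensive.
Import Order.TTheory GRing.Theory Num.Theory.
Import numFieldNormedType.Exports.
Import HBSimple.

(** A no-signaling behaviour with finitely many outcomes is a circulation on the
    4-partite digraph A_0 -> B_0 -> A_1 -> B_1 -> A_0, where A_x, B_y are copies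
    of the outcome set and the edges between A_x and B_y carry the weights of
    mu_{x,y}: no-signaling is flow conservation at every vertex. A circulation
    is a conic combination of simple directed cycles, and a simple cycle of
    length 4k is exactly a PR box of order k. A general no-signaling behaviour
    is the weak limit of its images under h_n x h_n, where the h_n are
    finite-valued and converge pointwise to the identity of R. Conversely, a
    weak limit of no-signaling behaviours is no-signaling because a probability
    measure on R is determined by the integrals of bounded continuous
    functions. *)

Local Open Scope ring_scope.

(** * Periodic orbits and the cyclic shift of indices *)

(** By pigeonhole the orbit of [s] reaches a periodic point [y]; the orbit of [y] over its least
    period has no repetition, and [F] acts on it as the cyclic successor [ordS]. *)
Lemma exists_iter_cycle (T : finType) (F : T -> T) (P : T -> Prop) (s : T) :
  P s -> (forall t, P t -> P (F t)) ->
  exists (k : nat) (c : 'I_k -> T),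
    [/\ (0 < k)%N, injective c, forall j, P (c j) &
        forall j, F (c j) = c (ordS j)].
Proof.
move=> Ps PF.
have Pit n t : P t -> P (iter n F t) by move=> Pt; elim: n => //= n; exact: PF.
have [y [d [d0 yd Py]]] : exists y d, [/\ (0 < d)%N, iter d F y = y & P y].
  have : ~~ uniq (traject F s #|T|.+1).
    apply/negP => /card_uniqP u.
    by have := max_card (mem (traject F s #|T|.+1)); rewrite u size_traject ltnn.
  rewrite looping_uniq negbK => /trajectP[i iT e].
  exists (iter i F s), (#|T| - i)%N; split; first by rewrite subn_gt0.
    by rewrite -iterD subnK 1?ltnW.
  by apply: Pit.
have ex : exists d, (0 < d)%N && (iter d F y == y) by exists d; rewrite d0 yd eqxx.
case: (ex_minnP ex) => k /andP[k0 /eqP yk] kmin.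
(* A repetition at [i < j < k] would make [k - j + i] a positive period of [y] smaller than [k]. *)
have aux i j : (i < j)%N -> (j < k)%N -> iter i F y = iter j F y -> False.
  move=> ij jk e.
  have := kmin (k - j + i)%N.
  rewrite iterD e -iterD subnK ?(ltnW jk)// yk eqxx andbT.
  by lia.
exists k, (fun j => iter j F y); split=> //.
- move=> i j e; apply/val_inj; case: (ltngtP i j) => // ij.
    by have := aux _ _ ij (ltn_ord j) e.
  by have := aux _ _ ij (ltn_ord i) (esym e).
- by move=> j; apply: Pit.
- move=> j /=; rewrite -iterS.
  have := ltn_ord j; rewrite leq_eqVlt => /orP[/eqP e|l].
    by rewrite e modnn.
  by rewrite modn_small.
Qed.

(** The map [j -> j + xy] modulo [k], written through [ordS] so that it is visibly a permutation of
    the indices. *)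
Definition pr_shift (x y : bool) k : 'I_k -> 'I_k :=
  if x && y then @ordS k else id.

Lemma pr_shift_bij x y k : bijective (@pr_shift x y k).
Proof.
rewrite /pr_shift; case: ifP => _; last by exists id.
exact: (Bijective (@ordSK k) (@ord_predK k)).
Qed.

(** * Decomposition of finite circulations into simple cycles *)

Section circulation.
Variables (R : realDomainType) (T : finType).
Implicit Types p : bool -> bool -> T -> T -> R.

(** The total mass is left free, so that the class is stable under subtracting a cycle of small
    enough weight. *)
Definition circulation p :=
  [/\ forall x y s t, 0 <= p x y s t,
      forall x s, \sum_t p x false s t = \sum_t p x true s t &
      forall y t, \sum_s p false y s t = \sum_s p true y s t].

Lemma psum_gt0_exists (f : T -> R) :
  (forall t, 0 <= f t) -> (0 < \sum_t f t) = [exists t, 0 < f t].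
Proof.
move=> f0; rewrite lt0r sumr_ge0 // andbT psumr_neq0 //.
by apply/hasP/existsP => [[t _]|[t]] ft; exists t => //; rewrite mem_index_enum.
Qed.

(** A positive entry makes its row sum positive, and row sums do not depend on [y]: flow that
    reaches a vertex can also leave it. *)
Lemma circulation_row p x y y' s t : circulation p ->
  0 < p x y s t -> exists t', 0 < p x y' s t'.
Proof.
move=> [p0 pA _] pxy; apply/existsP; rewrite -psum_gt0_exists //.
have : 0 < \sum_t p x y s t by rewrite psum_gt0_exists //; apply/existsP; exists t.
by case: y y' {pxy} => [] []; rewrite ?pA.
Qed.

Lemma circulation_col p x x' y s t : circulation p ->
  0 < p x y s t -> exists s', 0 < p x' y s' t.
Proof.
move=> [p0 _ pB] pxy; apply/existsP; rewrite -psum_gt0_exists //.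
have : 0 < \sum_s p x y s t by rewrite psum_gt0_exists //; apply/existsP; exists s.
by case: x x' {pxy} => [] []; rewrite ?pB.
Qed.

(** Choosing one positive edge at every vertex turns a trip around the four parts into a self-map
    [F] of the outcomes in A_0; a periodic orbit of [F] closes up into a cycle of positive edges. *)
Lemma circulation_cycle p x0 y0 s0 t0 : circulation p -> 0 < p x0 y0 s0 t0 ->
  exists (k : nat) (a b : bool -> 'I_k -> T),
    [/\ (0 < k)%N, forall x, injective (a x), forall y, injective (b y) &
        forall x y j, 0 < p x y (a x j) (b y (pr_shift x y j))].
Proof.
move=> cp p_gt0.
(* The default values of [odflt] are never taken along the cycle: [rowP] and [colP] guarantee a
   positive edge at each vertex visited. *)
pose row x y s := odflt s [pick t | 0 < p x y s t].
pose col x y t := odflt t [pick s | 0 < p x y s t].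
have rowP x y y' s t : 0 < p x y' s t -> 0 < p x y s (row x y s).
  move=> /(circulation_row y cp)[t' pt']; rewrite /row; case: pickP => //= N.
  by rewrite N in pt'.
have colP x x' y s t : 0 < p x' y s t -> 0 < p x y (col x y t) t.
  move=> /(circulation_col x cp)[s' ps']; rewrite /col; case: pickP => //= N.
  by rewrite N in ps'.
(* One turn around the cycle: A_0 -f1-> B_0 -f2-> A_1 -f3-> B_1 -f4-> A_0. *)
pose f1 := row false false.
pose f2 := col true false.
pose f3 := row true true.
pose f4 := col false true.
pose F s := f4 (f3 (f2 (f1 s))).
pose P s := exists t, 0 < p false false s t.
have P1 s : P s -> 0 < p false false s (f1 s) by move=> [t /rowP].
have P2 s : P s -> 0 < p true false (f2 (f1 s)) (f1 s) by move=> /P1 /colP.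
have P3 s : P s -> 0 < p true true (f2 (f1 s)) (f3 (f2 (f1 s))) by move=> /P2 /rowP.
have P4 s : P s -> 0 < p false true (F s) (f3 (f2 (f1 s))) by move=> /P3 /colP.
have [s Ps] : exists s, P s.
  have [s ps] := circulation_col false cp p_gt0.
  by have [t pt] := circulation_row false cp ps; exists s, t.
have PF t : P t -> P (F t).
  by move=> /P4 /(circulation_row false cp).
have [k [c [k0 cinj Pc cS]]] := exists_iter_cycle Ps PF.
(* [F \o c] factors through the vertices visited in B_0, A_1 and B_1, so its injectivity forces
   theirs. *)
have Fcinj : injective (F \o c) by move=> i j /=; rewrite !cS => /cinj /ordS_inj.
(* An edge enters B_1 from index j and leaves it to index j + 1, whence the
   shift by ord_pred. *)
exists k, (fun x => if x then f2 \o f1 \o c else c),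
  (fun y => if y then f3 \o f2 \o f1 \o c \o @ord_pred k else f1 \o c); split=> //.
- by move=> [] // i j /= e; apply: Fcinj; rewrite /= /F e.
- move=> [] i j /= e; last by apply: Fcinj; rewrite /= /F e.
  by apply: ord_pred_inj; apply: Fcinj; rewrite /= /F e.
- move=> [] [] j /=; rewrite /pr_shift /= ?ordSK; [exact: P3|exact: P2| |exact: P1].
  by rewrite -{1}(ord_predK j) -cS; exact: P4.
Qed.

(** The unnormalized weights of a PR box with outcomes in [T]: total mass [k] on each pair of
    settings. *)
Definition pr_count k (a b : bool -> 'I_k -> T) x y s t : R :=
  \sum_(j < k) ((a x j == s) && (b y (pr_shift x y j) == t))%:R.

Lemma pr_count_row k (a b : bool -> 'I_k -> T) x y s :
  \sum_t pr_count a b x y s t = \sum_(j < k) (a x j == s)%:R.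
Proof.
rewrite exchange_big /=; apply: eq_bigr => j _.
rewrite (bigD1 (b y (pr_shift x y j))) //= eqxx andbT big1 ?addr0 // => t.
by rewrite eq_sym => /negbTE->; rewrite andbF.
Qed.

Lemma pr_count_col k (a b : bool -> 'I_k -> T) x y t :
  \sum_s pr_count a b x y s t = \sum_(j < k) (b y j == t)%:R.
Proof.
rewrite exchange_big /= [RHS](reindex _ (onW_bij _ (pr_shift_bij x y k))) /=.
apply: eq_bigr => j _.
rewrite (bigD1 (a x j)) //= eqxx big1 ?addr0 // => s.
by rewrite eq_sym => /negbTE->.
Qed.

Lemma pr_countE k (a b : bool -> 'I_k -> T) x y j : injective (a x) ->
  pr_count a b x y (a x j) (b y (pr_shift x y j)) = 1.
Proof.
move=> ainj; rewrite /pr_count (bigD1 j) //= !eqxx big1 ?addr0 // => i ij.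
by rewrite (inj_eq ainj) (negbTE ij).
Qed.

Lemma pr_count_support k (a b : bool -> 'I_k -> T) x y s t :
  (forall j, a x j = s -> b y (pr_shift x y j) = t -> False) ->
  pr_count a b x y s t = 0.
Proof.
move=> N; apply: big1 => j _; case: eqP => // e1; case: eqP => // e2.
by have := N _ e1 e2.
Qed.

(** Take for [q] the least weight on the cycle: the difference stays nonnegative and the minimizing
    edge vanishes. Conservation survives because the row sums of [pr_count] depend only on [a x] and
    its column sums only on [b y]. *)
Lemma circulation_sub p k (a b : bool -> 'I_k -> T) :
  circulation p -> (0 < k)%N -> (forall x, injective (a x)) ->
  (forall x y j, 0 < p x y (a x j) (b y (pr_shift x y j))) ->
  exists q : R, let p' := fun x y s t => p x y s t - q * pr_count a b x y s t in
   [/\ 0 < q, circulation p',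
      forall x y s t, p x y s t = 0 -> p' x y s t = 0 &
      exists x y s t, p x y s t != 0 /\ p' x y s t = 0].
Proof.
move=> [p0 pA pB] k0 ainj ppos.
pose w (i : bool * bool * 'I_k) : R :=
  p i.1.1 i.1.2 (a i.1.1 i.2) (b i.1.2 (pr_shift i.1.1 i.1.2 i.2)).
case: (@arg_minP _ _ _ (false, false, Ordinal k0) xpredT w isT)
  => -[[x1 y1] j1] _ wmin.
(* Either the entry is an edge of the cycle, or nothing is subtracted from it. *)
have supp x y s t : (exists2 j, a x j = s & b y (pr_shift x y j) = t) \/
     pr_count a b x y s t = 0.
  have [/existsP[j /andP[/eqP e1 /eqP e2]]|/existsPn N] :=
    boolP [exists j, (a x j == s) && (b y (pr_shift x y j) == t)].
    by left; exists j.
  right; apply: pr_count_support => j e1 e2.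
  by have := N j; rewrite e1 e2 !eqxx.
exists (w (x1, y1, j1)); split.
- exact: ppos.
- split.
  + move=> x y s t; have [[j <- <-]|->] := supp x y s t; last by rewrite mulr0 subr0.
    by rewrite pr_countE // mulr1 subr_ge0; exact: (wmin (x, y, j)).
  + by move=> x s; rewrite !sumrB -!mulr_sumr !pr_count_row pA.
  + by move=> x s; rewrite !sumrB -!mulr_sumr !pr_count_col pB.
- move=> x y s t pz; have [[j e1 e2]|->] := supp x y s t;
    last by rewrite pz mulr0 subr0.
  by have := ppos x y j; rewrite e1 e2 pz ltxx.
- exists x1, y1, (a x1 j1), (b y1 (pr_shift x1 y1 j1)); split.
    by rewrite gt_eqF.
  by rewrite pr_countE // mulr1 subrr.
Qed.

(** Induction on the number of nonzero entries, which drops each time a cycle carrying its least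
    weight is removed. *)
Lemma circulation_ind (P : (bool -> bool -> T -> T -> R) -> Prop) :
  (forall p, (forall x y s t, p x y s t = 0) -> P p) ->
  (forall p q k (a b : bool -> 'I_k -> T), 0 < q -> (0 < k)%N ->
    (forall x, injective (a x)) -> (forall y, injective (b y)) ->
    P (fun x y s t => p x y s t - q * pr_count a b x y s t) -> P p) ->
  forall p, circulation p -> P p.
Proof.
move=> P0 PS p.
pose S p := [set i : bool * bool * T * T | p i.1.1.1 i.1.1.2 i.1.2 i.2 != 0].
have [n] := ubnP #|S p|; elim: n p => // n IH p pn cp.
have [S0|[[[[x y] s] t]]] := set_0Vmem (S p).
  apply: P0 => x y s t; apply/eqP/negbNE/negP => N.
  by have : (x, y, s, t) \in S p; [rewrite inE|rewrite S0 inE].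
rewrite inE /= => pn0.
have p_gt0 : 0 < p x y s t by have [p0 _ _] := cp; rewrite lt0r pn0 p0.
have [k [a [b [k0 ainj binj ppos]]]] := circulation_cycle cp p_gt0.
have [q [q0 cp' sub [x1 [y1 [s1 [t1 [pn1 p'0]]]]]]] :=
  circulation_sub cp k0 ainj ppos.
apply: (PS _ q k a b) => //; apply: IH => //.
rewrite -ltnS; apply: leq_trans pn; rewrite ltnS; apply: proper_card.
apply/properP; split.
  apply/fintype.subsetP => -[[[x2 y2] s2] t2]; rewrite !inE /=.
  apply: contra => /eqP.
  by move=> /sub ->.
by exists (x1, y1, s1, t1); rewrite !inE //= p'0 eqxx.
Qed.

End circulation.

(** * Circulations as mixtures of PR boxes *)

Local Open Scope classical_set_scope.
Local Open Scope ring_scope.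

Lemma measure_fibers d (X : measurableType d) (R : realType)
    (mu : {measure set X -> \bar R}) (I : finType) (phi : X -> I) (D : {pred I}) :
  (forall i, measurable (phi @^-1` [set i])) ->
  mu [set x | phi x \in D] = (\sum_(i in D) mu (phi @^-1` [set i]))%E.
Proof.
move=> mphi.
have -> : [set x | phi x \in D] = \bigcup_(i in [set` D]) phi @^-1` [set i].
  by apply/seteqP; split => [x Dx|x [i Di /= ixE]]; [exists (phi x)|rewrite /= ixE].
rewrite measure_fin_bigcup //.
- rewrite [RHS]bigfs ?index_enum_uniq //.
  by move=> i _; rewrite mem_index_enum.
- by move=> i j _ _ [x [/= <- <-]].
Qed.

Lemma pr_shiftE k (kpos : (0 < k)%N) (x y : bool) (j : 'I_k) :
  Ordinal (ltn_pmod (j + (x * y)%N) kpos) = pr_shift x y j.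
Proof.
apply: val_inj; rewrite /pr_shift.
by case: x y => [] [] /=; rewrite ?addn1 // addn0 modn_small.
Qed.

Lemma uniform_pmeasR2 (R : realType) k (z : 'I_k -> R * R) : (0 < k)%N ->
  exists P : pmeasR2 R, forall A, measurable A ->
    P A = (\sum_(j < k) ((k%:R)^-1)%:E * \d_(z j) A)%E.
Proof.
move=> k0.
(* [msum] is indexed by natural numbers, so [z] is extended periodically; only indices below [k]
   enter the sum. *)
pose z' n := z (Ordinal (ltn_pmod n k0)).
pose m : {measure set (R * R)%type -> \bar R} :=
  msum (fun n => \d_(z' n) : {measure set (R * R)%type -> \bar R}) k.
(* mnormalize requires a default probability, irrelevant here as m is nonzero. *)
exists (mnormalize m (\d_(z (Ordinal k0)) : pmeasR2 R)) => A mA.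
have mT : m setT = (k%:R)%:E.
  rewrite /m /= /msum (eq_bigr (fun=> 1%:E)); last by move=> i _; exact: diracT.
  by rewrite sumEFin sumr_const card_ord.
rewrite /= /mnormalize mT eqe pnatr_eq0 (gtn_eqF k0) /= muleC.
rewrite /m /= /msum ge0_sume_distrr //.
apply: eq_bigr => j _; congr (_ * \d_(z _) A)%E.
by apply: val_inj; rewrite /= modn_small.
Qed.

Lemma PR_box_exists (R : realType) (k : nat) (a b : bool -> 'I_k -> R) :
  (0 < k)%N -> (forall x, injective (a x)) -> (forall y, injective (b y)) ->
  exists B : behaviour R, is_PR_box B /\
    forall x y A, measurable A -> B x y A =
     (\sum_(j < k) ((k%:R)^-1)%:E * \d_(a x j, b y (pr_shift x y j)) A)%E.
Proof.
move=> k0 ainj binj.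
have Bx x y := uniform_pmeasR2 (fun j => (a x j, b y (pr_shift x y j))) k0.
exists (fun x y => sval (cid (Bx x y))).
have BE x y A : measurable A -> sval (cid (Bx x y)) A =
     (\sum_(j < k) ((k%:R)^-1)%:E * \d_(a x j, b y (pr_shift x y j)) A)%E.
  exact: (svalP (cid (Bx x y))).
split=> //; exists k, k0, a, b; do 2!split=> //.
by move=> x y A mA; rewrite BE //; apply: eq_bigr => j _; rewrite pr_shiftE.
Qed.

Lemma sum_dirac2E (R : realType) (T : finType) (v : T -> R) (w : T -> T -> R)
    (A : set (R * R)%type) :
  (\sum_s \sum_t (w s t)%:E * \d_(v s, v t) A =
   (\sum_s \sum_t w s t * ((v s, v t) \in A)%:R)%:E)%E.
Proof.
rewrite -sumEFin; apply: eq_bigr => s _; rewrite -sumEFin; apply: eq_bigr => t _.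
by rewrite diracE -EFinM.
Qed.

(** The cycle decomposition read through [v], which places the outcomes in R. The coefficients are
    only nonnegative here, since the circulation has no prescribed mass. *)
Lemma circulation_PR_boxes (R : realType) (T : finType) (v : T -> R)
    (p : bool -> bool -> T -> T -> R) :
  injective v -> circulation p ->
  exists c : seq (R * behaviour R),
    (forall i, i \in c -> 0 <= i.1 /\ is_PR_box i.2) /\
    forall x y A, measurable A ->
      (\sum_s \sum_t (p x y s t)%:E * \d_(v s, v t) A =
       \sum_(i <- c) i.1%:E * i.2 x y A)%E.
Proof.
move=> vinj; move: p; apply: circulation_ind => [p p0|p q k a b q0 k0 ainj binj].
  exists [::]; split=> // x y A _; rewrite big_nil big1 // => s _.
  by rewrite big1 // => t _; rewrite p0 mul0e.
move=> [c [cP cE]].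
have [B [BPR BE]] := @PR_box_exists R k (fun x => v \o a x) (fun y => v \o b y) k0
  (fun x => inj_comp vinj (ainj x)) (fun y => inj_comp vinj (binj y)).
(* The factor [k] compensates the [1/k] in the definition of a PR box. *)
exists ((q * k%:R, B) :: c); split.
  move=> i; rewrite inE => /orP[/eqP->|/cP//]; split => //=.
  by rewrite mulr_ge0 ?ler0n // ltW.
move=> x y A mA; rewrite big_cons -cE //= BE //.
have -> : ((q * k%:R)%:E *
    (\sum_(j < k) (k%:R^-1)%:E * \d_(v (a x j), v (b y (pr_shift x y j))) A) =
    \sum_s \sum_t (q * pr_count R a b x y s t)%:E * \d_(v s, v t) A)%E.
  rewrite sum_dirac2E.
  under eq_bigr => j _ do rewrite diracE -EFinM.
  rewrite sumEFin -EFinM; congr (_%:E).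
  rewrite -mulr_sumr mulrA mulfK ?pnatr_eq0 -?lt0n // mulr_sumr.
  (* With the sum over [j] moved outermost, only [s = a x j] and [t = b y (pr_shift x y j)]
     contribute. *)
  under [RHS]eq_bigr => s _ do under eq_bigr => t _ do
    rewrite /pr_count mulr_sumr mulr_suml.
  under [RHS]eq_bigr => s _ do rewrite exchange_big /=.
  rewrite exchange_big /=; apply: eq_bigr => j _.
  rewrite (bigD1 (a x j)) //= (bigD1 (b y (pr_shift x y j))) //= !eqxx mulr1.
  rewrite !big1 ?addr0 // => [s sa|t tb].
    by rewrite big1 // => t _; rewrite eq_sym (negbTE sa) mulr0 mul0r.
  by rewrite [_ == t]eq_sym (negbTE tb) mulr0 mul0r.
rewrite !sum_dirac2E -EFinD -big_split; congr (_%:E); apply: eq_bigr => s _.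
rewrite -big_split; apply: eq_bigr => t _ /=.
by rewrite -mulrDl [_ + (_ - _)]addrC subrK.
Qed.

Lemma finite_conv_PR (R : realType) (T : finType) (v : T -> R)
    (p : bool -> bool -> T -> T -> R) (mu : behaviour R) :
  injective v -> circulation p ->
  (forall x y A, measurable A ->
    mu x y A = (\sum_s \sum_t (p x y s t)%:E * \d_(v s, v t) A)%E) ->
  in_conv_PR mu.
Proof.
move=> vinj cp muE; have [c [cP cE]] := circulation_PR_boxes vinj cp.
pose c' i := tnth (in_tuple c) i.
have c'P i : 0 <= (c' i).1 /\ is_PR_box (c' i).2 by apply: cP; rewrite mem_tnth.
exists (size c), (fun i => (c' i).1), (fun i => (c' i).2).
have E x y A : measurable A ->
    mu x y A = (\sum_(i < size c) (c' i).1%:E * (c' i).2 x y A)%E.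
  by move=> mA; rewrite muE // cE // big_tnth.
split; [|split; [|split]] => //; try by move=> i; case: (c'P i).
(* Evaluating on the whole space, where all measures have mass 1, shows that the coefficients sum to
   1. *)
have := E false false setT measurableT; rewrite probability_setT.
under eq_bigr => i _ do rewrite probability_setT mule1.
by rewrite sumEFin => -[].
Qed.

(** * Discretization of a no-signaling behaviour *)

Lemma measurable_map2 (R : realType) (h : R -> R) : measurable_fun setT h ->
  measurable_fun setT (fun z : (R * R)%type => (h z.1, h z.2)).
Proof.
move=> mh; apply: measurable_fun_pair.
  exact: measurableT_comp.
exact: measurableT_comp.
Qed.

Definition map2_behaviour (R : realType) (h : R -> R) (mh : measurable_fun setT h)
    (mu : behaviour R) : behaviour R := fun x y =>
  distribution (mu x y) (mfun_Sub (mem_set (measurable_map2 mh))).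

(** The fibres of [g] cut the plane into finitely many rectangles. Their masses form a circulation:
    no-signaling applied to a fibre of [g] is conservation at the corresponding vertex. *)
Lemma map2_behaviour_conv_PR (R : realType) (T : finType) (g : R -> T)
    (v : T -> R) (mh : measurable_fun setT (v \o g)) (mu : behaviour R) :
  injective v -> no_signaling mu -> in_conv_PR (map2_behaviour mh mu).
Proof.
move=> vinj [nsA nsB].
have mg t : measurable (g @^-1` [set t]).
  (* Only [v \o g] is known to be measurable; since [v] is injective, its fibres over values of [v]
     are those of [g]. *)
  rewrite (_ : _ @^-1` _ = (v \o g) @^-1` [set v t]).
    by rewrite -[X in measurable X]setTI; apply: mh => //; exact: measurable_set1.
  by apply/seteqP; split => z /= => [->//|/vinj].
pose G z := (g z.1, g z.2).
have GE i : G @^-1` [set i] = (g @^-1` [set i.1]) `*` (g @^-1` [set i.2]).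
  case: i => s t; apply/seteqP; split => -[z1 z2] [e1 e2] /=; first by [].
  by rewrite /G /=; move: e1 e2 => /= -> ->.
have mG i : measurable (G @^-1` [set i]) by rewrite GE; exact: measurableX.
pose p x y s t := fine (mu x y (G @^-1` [set (s, t)])).
have pE x y s t : (p x y s t)%:E = mu x y (G @^-1` [set (s, t)]).
  by rewrite fineK // fin_num_measure.
(* Mass of an arbitrary union of cells; it serves for rows, for columns, and for the image
   measure. *)
have sumD x y (D : {pred T * T}) :
    mu x y [set z | G z \in D] =
    (\sum_s \sum_(t | (s, t) \in D) (p x y s t)%:E)%E.
  rewrite measure_fibers // pair_big_dep /=.
  by apply: eq_big => [[s t]|[s t] _] //; rewrite pE.
apply: (@finite_conv_PR R T v p) => //.
- split=> [x y s t|x s|y t].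
  + by rewrite fine_ge0.
  + have E y : mu x y ((g @^-1` [set s]) `*` setT) = (\sum_t p x y s t)%:E.
      transitivity (mu x y [set z | G z \in [pred i | i.1 == s]]).
        congr (mu x y _); apply/seteqP; split => z; rewrite /= inE /=.
          by move=> [-> _].
        by move=> /eqP.
      rewrite sumD (bigD1 s) //= [X in (_ + X)%E]big1 ?adde0 => [|s' s's].
        by rewrite -sumEFin; apply: eq_bigl => t; rewrite inE /= eqxx.
      by apply: big_pred0 => t; rewrite inE /= (negbTE s's).
    by apply: EFin_inj; rewrite -!E nsA.
  + have E x : mu x y (setT `*` (g @^-1` [set t])) = (\sum_s p x y s t)%:E.
      transitivity (mu x y [set z | G z \in [pred i | i.2 == t]]).
        congr (mu x y _); apply/seteqP; split => z; rewrite /= inE /=.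
          by move=> [_ ->].
        by move=> /eqP.
      rewrite sumD -sumEFin; apply: eq_bigr => s _.
      by rewrite (eq_bigl (pred1 t)) ?big_pred1_eq // => t'; rewrite inE.
    by apply: EFin_inj; rewrite -!E nsB.
- move=> x y A mA.
  transitivity (mu x y [set z | G z \in [pred i | (v i.1, v i.2) \in A]]).
    by congr (mu x y _); apply/seteqP; split => z /=; rewrite !inE.
  rewrite sumD; apply: eq_bigr => s _; rewrite big_mkcond /=.
  apply: eq_bigr => t _; rewrite diracE inE /=.
  by case: ifP => _; rewrite ?mule1 ?mule0.
Qed.

(** Simple functions approximating the embedding [EFin] of R into the extended reals; the limits are
    finite, so convergence holds in R. *)
Lemma approximation_fimfun (R : realType) : exists h : nat -> R -> R,
  [/\ forall n, measurable_fun setT (h n), forall n, finite_set (range (h n)) &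
      forall x, h ^~ x @ \oo --> x].
Proof.
have [h hE] := approximation_sfun measurableT (@EFin_measurable R setT).
exists (fun n => h n : R -> R); split => [n|n|x].
- exact: (measurable_funPT (h n)).
- exact: (fimfunP (h n)).
- have /fine_cvgP[_] := hE x I.
  exact.
Qed.

Lemma map2_finite_conv_PR (R : realType) (h : R -> R) (mh : measurable_fun setT h)
    (mu : behaviour R) :
  finite_set (range h) -> no_signaling mu -> in_conv_PR (map2_behaviour mh mu).
Proof.
move=> hfin nsmu.
have hin z : h z \in fset_set (range h) by rewrite in_fset_set // inE; exists z.
pose g z : fset_set (range h) := [` hin z]%fset.
exact: (@map2_behaviour_conv_PR R _ g (fun t => val t) mh mu val_inj nsmu).
Qed.

Lemma continuous_cvg_map2 (R : realType) (f : R * R -> R) (h : nat -> R -> R) a b :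
  continuous f -> (forall x, h ^~ x @ \oo --> x) ->
  f (h n a, h n b) @[n --> \oo] --> f (a, b).
Proof.
move=> cf hcvg.
have hab : (h n a, h n b) @[n --> \oo] --> (a, b).
  exact: (cvg_pair (hcvg a) (hcvg b)).
exact: (cvg_comp _ _ hab (cf (a, b))).
Qed.

(** Measurability is for the product sigma-algebra: [f] is the pointwise limit of its compositions
    with [h n] on both coordinates, each constant on finitely many measurable rectangles. *)
Lemma continuous_measurable_prod (R : realType) (f : R * R -> R) :
  continuous f -> measurable_fun setT f.
Proof.
move=> cf; have [h [mh hfin hcvg]] := approximation_fimfun R.
apply: (@measurable_fun_cvg _ _ _ _ (fun n z => f (h n z.1, h n z.2))).
  move=> n _ Y mY; rewrite setTI.
  pose D := (range (h n) `*` range (h n)) `&` (f @^-1` Y).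
  have -> : (fun z : R * R => f (h n z.1, h n z.2)) @^-1` Y =
      \bigcup_(i in D) ((h n @^-1` [set i.1]) `*` (h n @^-1` [set i.2])).
    apply/seteqP; split => -[a b] /= => [Yab|[[a' b'] [_ Yab] [/= -> ->]] //].
    by exists (h n a, h n b).
  apply: fin_bigcup_measurable.
    by apply: finite_setIl; apply: finite_setX.
  move=> [a b] _; apply: measurableX => /=; rewrite -[X in measurable X]setTI;
    by apply: mh => //; exact: measurable_set1.
move=> [a b] _ /=.
exact: (continuous_cvg_map2 (a:=a) (b:=b) cf hcvg).
Qed.


Lemma bounded_integrable d (X : measurableType d) (R : realType)
    (P : probability X R) (f : X -> R) (M : R) :
  measurable_fun setT f -> (forall z, `|f z| <= M) ->
  P.-integrable setT (EFin \o f).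
Proof.
move=> mf fM; apply: measurable_bounded_integrable => //.
  by rewrite -ge0_fin_numE ?fin_num_measure.
exists M; split; first by rewrite num_real.
by move=> N MN z _; apply: le_trans (fM z) (ltW MN).
Qed.

(** Change of variables moves [h n] into the integrand; continuity of [f] gives pointwise
    convergence, and the bound [M] allows dominated convergence. *)
Lemma map2_behaviour_weak_cvg (R : realType) (h : nat -> R -> R)
    (mh : forall n, measurable_fun setT (h n)) (mu : behaviour R) :
  (forall x, h ^~ x @ \oo --> x) ->
  weak_cvg (fun n => map2_behaviour (mh n) mu) mu.
Proof.
move=> hcvg x y f [cf [M fM]].
have mf := continuous_measurable_prod cf.
have mfh n : measurable_fun setT (fun z : (R * R)%type => f (h n z.1, h n z.2)).
  exact: (measurableT_comp mf (measurable_map2 (mh n))).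
have E n : integ (map2_behaviour (mh n) mu x y) f =
    (\int[mu x y]_z (f (h n z.1, h n z.2))%:E)%E.
  rewrite /integ /map2_behaviour integral_distribution //=.
    exact/measurable_EFinP.
  by apply: (@bounded_integrable _ _ _ (mu x y) (fun z => f (h n z.1, h n z.2)) M).
rewrite (_ : (fun n => _) = (fun n => \int[mu x y]_z (f (h n z.1, h n z.2))%:E)%E);
  last by apply/funext => n; exact: E.
apply: (@dominated_cvg _ _ _ _ _ _ _ _ (fun=> M%:E)) => //.
- by move=> n; exact/measurable_EFinP.
- move=> [a b] _ /=; apply: cvg_EFin; first exact: nearW.
  exact: (continuous_cvg_map2 (a:=a) (b:=b) cf hcvg).
- exact: (finite_measure_integrable_cst (mu x y) M measurableT).
- by move=> n z _; rewrite lee_fin.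
Qed.

Lemma NS_weak_limit (R : realType) (mu : behaviour R) : no_signaling mu ->
  exists mun : nat -> behaviour R,
    (forall n, in_conv_PR (mun n)) /\ weak_cvg mun mu.
Proof.
move=> nsmu; have [h [mh hfin hcvg]] := approximation_fimfun R.
exists (fun n => map2_behaviour (mh n) mu); split.
  by move=> n; exact: map2_finite_conv_PR.
exact: map2_behaviour_weak_cvg.
Qed.

(** * No-signaling of convex combinations of PR boxes *)

Lemma PR_box_no_signaling (R : realType) (mu : behaviour R) :
  is_PR_box mu -> no_signaling mu.
Proof.
move=> [k [k0 [a [b [_ [_ muE]]]]]]; split=> [x A mA|y B mB].
  rewrite !muE; [|exact: measurableX..].
  by apply: eq_bigr => j _; rewrite !diracE !in_setX !in_setT.
rewrite !muE; [|exact: measurableX..].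
pose F (x : bool) (j : 'I_k) :=
  ((k%:R^-1)%:E * \d_(b y (pr_shift x y j)) B : \bar R)%E.
rewrite [LHS](eq_bigr (F false)) => [|j _]; last first.
  by rewrite /F pr_shiftE !diracE !in_setX !in_setT.
rewrite [RHS](eq_bigr (F true)) => [|j _]; last first.
  by rewrite /F pr_shiftE !diracE !in_setX !in_setT.
(* The shift only permutes the indices, so the second marginal is uniform on the [b y j] for either
   [x]. *)
have E x : \sum_j F x j = \sum_(j < k) ((k%:R^-1)%:E * \d_(b y j) B)%E.
  by rewrite [RHS](reindex _ (onW_bij _ (pr_shift_bij x y k))).
by rewrite !E.
Qed.

Lemma conv_PR_no_signaling (R : realType) (mu : behaviour R) :
  in_conv_PR mu -> no_signaling mu.
Proof.
move=> [n [q [B [_ [_ [BPR muE]]]]]]; split=> [x A mA|y A mA].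
  rewrite !muE; [|exact: measurableX..].
  by apply: eq_bigr => i _; have [-> //] := PR_box_no_signaling (BPR i).
rewrite !muE; [|exact: measurableX..].
by apply: eq_bigr => i _; have [_ ->] := PR_box_no_signaling (BPR i).
Qed.

(** * Continuous test functions determine a probability measure on R *)

Lemma continuous_expR_min0 (R : realType) (x : R) :
  continuous (fun t : R => expR (Num.min 0 (t - x))).
Proof.
move=> t; apply: continuous_comp; last exact: continuous_expR.
apply: continuous_min; first exact: cvg_cst.
by apply: cvgB; [exact: cvg_id|exact: cvg_cst].
Qed.

(** Closed right rays are stable under intersection and generate the Borel sets, so it is enough to
    recover their masses as limits of integrals of continuous functions bounded by 1. *)
Lemma probability_ext_continuous (R : realType) (P Q : probability R R) :
  (forall h : R -> R, continuous h -> (forall t, `|h t| <= 1) ->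
     (\int[P]_t (h t)%:E = \int[Q]_t (h t)%:E)%E) ->
  forall A, measurable A -> P A = Q A.
Proof.
move=> PQ.
have PQray (x : R) : P `[x, +oo[%classic = Q `[x, +oo[%classic.
  (* u <= 1 with equality exactly on the ray, so u ^ n decreases to its
     indicator. *)
  pose u (t : R) := expR (Num.min 0 (t - x)).
  have u0 t : 0 <= u t by exact: expR_ge0.
  have u1 t : u t <= 1 by rewrite -expR0 ler_expR ge_min lexx.
  have cu n : continuous (fun t => u t ^+ n).
    move=> t; apply: (@continuous_comp _ _ _ u (fun z => z ^+ n)).
      exact: continuous_expR_min0.
    exact: exprn_continuous.
  have bu n t : `|u t ^+ n| <= 1 by rewrite ger0_norm ?exprn_ge0// exprn_ile1.
  have lim (P' : probability R R) :
      (\int[P']_t (u t ^+ n)%:E)%E @[n --> \oo] --> P' `[x, +oo[%classic.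
    have -> : P' `[x, +oo[%classic = (\int[P']_t (\1_(`[x, +oo[%classic) t)%:E)%E.
      by rewrite integral_indic // setIT.
    apply: (@dominated_cvg _ _ _ _ _ _ _ _ (fun=> 1%E)) => //.
    - move=> n; apply/measurable_EFinP; exact: continuous_measurable_fun.
    - move=> t _; apply: cvg_EFin; first exact: nearW.
      have [xt|tx] := leP x t; rewrite indicE.
        rewrite mem_set; last by rewrite /= in_itv /= xt.
        rewrite (_ : _ \o _ = cst 1); first exact: cvg_cst.
        by apply/funext => n /=; rewrite /u min_l ?subr_ge0 // expR0 expr1n.
      rewrite memNset; last by rewrite /= in_itv /= leNgt tx.
      apply: cvg_expr; rewrite ger0_norm // -expR0 ltr_expR gt_min subr_lt0.
      by rewrite tx orbT.
    - exact: (finite_measure_integrable_cst P' 1 measurableT).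
    - by move=> n t _; rewrite lee_fin.
  have := lim Q; rewrite (_ : (fun n => _) = (fun n => (\int[P]_t (u t ^+ n)%:E)%E)).
    by move=> limQ; apply: cvg_unique (lim P) limQ.
  by apply/funext => n; rewrite PQ.
apply: (measure_unique (@RGenCInfty.G R) (fun n => `[- n%:R, +oo[%classic)).
- exact: RGenCInfty.measurableE.
- move=> _ _ [x ->] [y ->]; exists (Num.max x y).
  apply/seteqP; split => t /=; rewrite !in_itv /= !andbT ge_max.
    by move=> [-> ->].
  by move=> /andP[].
- by move=> n; exists (- n%:R).
- apply/seteqP; split => // t _; exists (Num.truncn (- t)).+1 => //=.
  by rewrite in_itv /= andbT lerNl ltW // truncnS_gt.
- by move=> _ [x ->]; exact: PQray.
- by move=> n; rewrite -ge0_fin_numE ?fin_num_measure.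
Qed.

(** * No-signaling passes to the weak closure *)

Lemma integ_fin_num (R : realType) (P : pmeasR2 R) (f : R * R -> R) :
  bounded_continuous f -> integ P f \is a fin_num.
Proof.
move=> [cf [M fM]]; apply: integrable_fin_num => //.
exact: (@bounded_integrable _ _ _ P f M (continuous_measurable_prod cf) fM).
Qed.

Lemma integ_distribution (R : realType) (P : pmeasR2 R)
    (phi : {mfun (R * R)%type >-> R}) (h : R -> R) :
  continuous h -> (forall t, `|h t| <= 1) ->
  integ P (h \o phi) = (\int[distribution P phi]_t (h t)%:E)%E.
Proof.
move=> ch h1.
have mh : measurable_fun setT h by exact: continuous_measurable_fun.
rewrite integral_distribution //; first exact/measurable_EFinP.
apply: (@bounded_integrable _ _ _ P (h \o phi) 1).
  exact: measurableT_comp.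
by move=> z; exact: h1.
Qed.

Lemma eq_marginal_integ (R : realType) (P Q : pmeasR2 R)
    (phi : {mfun (R * R)%type >-> R}) (h : R -> R) :
  (forall A, measurable A -> P (phi @^-1` A) = Q (phi @^-1` A)) ->
  continuous h -> (forall t, `|h t| <= 1) ->
  integ P (h \o phi) = integ Q (h \o phi).
Proof.
move=> PQ ch h1; rewrite !integ_distribution //.
by apply: eq_measure_integral => A mA _; exact: PQ.
Qed.

(** Equality of two integrals is a closed condition: a [nu] satisfying it and within [e / 2] of [mu]
    for both integrals leaves a gap of at most [e], for every [e]. *)
Lemma weak_closure_integ_eq (R : realType) (mu : behaviour R)
    (i j : bool * bool) (f : R * R -> R) :
  in_weak_closure_conv_PR mu -> bounded_continuous f ->
  (forall nu, in_conv_PR nu -> integ (nu i.1 i.2) f = integ (nu j.1 j.2) f) ->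
  integ (mu i.1 i.2) f = integ (mu j.1 j.2) f.
Proof.
move=> clmu bf nuE.
have fin P := integ_fin_num P bf.
rewrite -[LHS]fineK // -[RHS]fineK //; congr (_%:E).
apply/eqP; rewrite -subr_eq0 -normr_le0; apply/ler_addgt0Pl => e e0; rewrite addr0.
have bij t : t \in [:: (i, f); (j, f)] -> bounded_continuous t.2.
  by rewrite !inE => /orP[]/eqP ->.
have [nu [/nuE nuij nunear]] :=
  clmu [:: (i, f); (j, f)] _ bij (divr_gt0 e0 (ltr0n _ 2)).
have near1 := nunear (i, f) (mem_head _ _).
have near2 := nunear (j, f) (mem_last (i, f) [:: (j, f)]).
move: near1 near2; rewrite /= nuij.
rewrite -(fineK (fin (mu i.1 i.2))) -(fineK (fin (mu j.1 j.2)))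
  -(fineK (fin (nu _ _))) /=.
rewrite !lte_fin => near1 near2; rewrite distrC in near1.
rewrite [e]splitr (le_trans (ler_distD (fine (integ (nu j.1 j.2) f)) _ _)) //.
by rewrite lerD // ltW.
Qed.

(** Meant for [phi] a coordinate projection. The test functions [h \o phi] are bounded and
    continuous, and they determine the law of [phi]. *)
Lemma weak_closure_marginal (R : realType) (mu : behaviour R)
    (i j : bool * bool) (phi : {mfun (R * R)%type >-> R}) :
  in_weak_closure_conv_PR mu -> continuous phi ->
  (forall nu A, in_conv_PR nu -> measurable A ->
    nu i.1 i.2 (phi @^-1` A) = nu j.1 j.2 (phi @^-1` A)) ->
  forall A, measurable A ->
    mu i.1 i.2 (phi @^-1` A) = mu j.1 j.2 (phi @^-1` A).
Proof.
move=> clmu cphi nuE.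
apply: (@probability_ext_continuous _ (distribution (mu i.1 i.2) phi)
                                      (distribution (mu j.1 j.2) phi)) => h ch h1.
have mh : measurable_fun setT h by exact: continuous_measurable_fun.
rewrite -!integ_distribution //.
apply: weak_closure_integ_eq => //.
  split; last by exists 1 => z; exact: h1.
  by move=> z; apply: continuous_comp; [exact: cphi|exact: ch].
by move=> nu nuPR; apply: eq_marginal_integ => // A mA; exact: nuE.
Qed.

Lemma weak_closure_no_signaling (R : realType) (mu : behaviour R) :
  in_weak_closure_conv_PR mu -> no_signaling mu.
Proof.
move=> clmu.
have E1 (A : set R) : A `*` setT = fst @^-1` A :> set (R * R).
  by apply/seteqP; split => z /=; [case|split].
have E2 (B : set R) : setT `*` B = snd @^-1` B :> set (R * R).
  by apply/seteqP; split => z /=; [case|split].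
split=> [x A mA|y B mB].
  rewrite E1; apply: (@weak_closure_marginal R mu (x, false) (x, true)
    (mfun_Sub (mem_set (@measurable_fst _ _ R R)))) => //=.
    by move=> z; exact: cvg_fst.
  move=> nu A' /conv_PR_no_signaling[nuA _] mA'.
  by have := nuA x A' mA'; rewrite !E1.
rewrite E2; apply: (@weak_closure_marginal R mu (false, y) (true, y)
  (mfun_Sub (mem_set (@measurable_snd _ _ R R)))) => //=.
  by move=> z; exact: cvg_snd.
move=> nu B' /conv_PR_no_signaling[_ nuB] mB'.
by have := nuB y B' mB'; rewrite !E2.
Qed.

(** * From weak sequential limits to the weak closure *)

Lemma no_signaling_weak_closure (R : realType) (mu : behaviour R) :
  no_signaling mu -> in_weak_closure_conv_PR mu.
Proof.
move=> nsmu s eps bs eps0; have [mun [munPR mun_cvg]] := NS_weak_limit nsmu.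
suff [N _ HN] : \forall n \near \oo, forall t, t \in s ->
    (`| integ (mun n t.1.1 t.1.2) t.2 - integ (mu t.1.1 t.1.2) t.2 | < eps%:E)%E.
  by exists (mun N); split => //; apply: HN => /=.
(* A basic neighbourhood imposes finitely many conditions; each holds eventually along the sequence,
   hence so do all together. *)
elim: s bs => [|t s IH] bs; first exact: nearW.
have bt := bs t (mem_head _ _).
have tcvg := mun_cvg t.1.1 t.1.2 t.2 bt.
have fin P := integ_fin_num P bt.
have tnear : \forall n \near \oo,
    (`| integ (mun n t.1.1 t.1.2) t.2 - integ (mu t.1.1 t.1.2) t.2 | < eps%:E)%E.
  rewrite -(fineK (fin (mu t.1.1 t.1.2))) in tcvg *.
  have /fine_cvgP[_ /cvgrPdist_lt/(_ _ eps0)] := tcvg.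
  apply: filterS => n /=; rewrite distrC -lte_fin.
  by rewrite -[in X in _ -> X](fineK (fin (mun n _ _))) -EFinB /=.
have snear := IH (fun t' t's => bs t' (mem_behead (s := t :: s) t's)).
apply: filterS2 tnear snear => n tn sn t'; rewrite inE => /orP[/eqP->//|].
exact: sn.
Qed.

Theorem theorem1 (R : realType) :
  (forall mu : behaviour R, in_weak_closure_conv_PR mu <-> no_signaling mu) /\
  (forall mu : behaviour R, no_signaling mu ->
     exists mun : nat -> behaviour R,
       (forall n, in_conv_PR (mun n)) /\ weak_cvg mun mu).
Proof.
split=> mu; last exact: NS_weak_limit.
by split; [exact: weak_closure_no_signaling|exact: no_signaling_weak_closure].
Qed.
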